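(* Let $\beta>1$ be a non-integer and let $\lambda\in\mathbb{C}$ be a non-leading eigenvalue of the Perron-Frobenius operator $\mathcal{L}_\beta$. Then for any eigenfunctional $\nu\in\widehat{BV}^*$ corresponding to $\lambda$, there is no complex-valued measure $m$ on $[0,1]$ such that $$\nu(f)=\int_0^1 f\,dm$$ for all $f\in\widehat{BV}$.
   Context: For real $\beta>1$, the beta-map is $\tau_\beta:[0,1]\to[0,1]$, $\tau_\beta(x)=\beta x-[\beta x]$, where $[y]$ is the integer part of $y\ge 0$. Let $BV$ be the Banach space of functions $f:[0,1]\to\mathbb{C}$ of bounded variation with norm $\|f\|_{BV}=\operatorname{var}(f)+\sup_{x\in[0,1]}|f(x)|$, let $\mathcal{N}\subset BV$ be the closed subspace of those $f\in BV$ that vanish outside some countable set, and let $\widehat{BV}=BV/\mathcal{N}$ with the quotient norm. The Perron-Frobenius operator $\mathcal{L}_\beta f(x)=\frac1\beta\sum_{y\in[0,1],\,\tau_\beta(y)=x}f(y)$ is considered as a bounded operator on $\widehat{BV}$. Every spectral value $\lambda$ of $\mathcal{L}_\beta$ with $|\lambda|>1/\beta$ is an isolated eigenvalue of finite multiplicity and satisfies $|\lambda|\le 1$. The number $1$ is the leading eigenvalue; a non-leading eigenvalue is an eigenvalue $\lambda\neq1$ with $|\lambda|>1/\beta$ (it then satisfies $1/\beta<|\lambda|<1$). $\widehat{BV}^*$ is the space of bounded complex-valued linear functionals on $\widehat{BV}$, and the dual operator is $(\mathcal{L}_\beta^*\nu)(f)=\nu(\mathcal{L}_\beta f)$. An eigenfunctional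 corresponding to $\lambda$ is a nonzero $\nu\in\widehat{BV}^*$ with $\mathcal{L}_\beta^*\nu=\lambda\nu$. A complex-valued measure on $[0,1]$ is a (finite) complex Borel measure. The equality $\nu(f)=\int_0^1f\,dm$ for all $f\in\widehat{BV}$ means that for every function $f\in BV$ the value of $\nu$ at the class of $f$ equals $\int_0^1f\,dm$. *)

(* Defs.v *)
From HB Require Import structures.
From mathcomp Require Import all_boot all_order all_algebra.
From mathcomp Require Import all_classical all_reals all_analysis.
From mathcomp Require Import complex ring.

Set Implicit Arguments.
Unset Strict Implicit.
Unset Printing Implicit Defensive.

Import Order.TTheory GRing.Theory Num.Theory.
Import numFieldNormedType.Exports.
Import ComplexField.Normc.

Local Open Scope classical_set_scope.
Local Open Scope ring_scope.
Local Open Scope complex_scope.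
Local Open Scope quotient_scope.

Definition unitI (R : realType) : Type := set_type `[0%R : R, 1]%classic.

HB.instance Definition _ (R : realType) := SubChoice.on (unitI R).
HB.instance Definition _ (R : realType) :=
  [SubChoice_isSubOrder of unitI R by <: with ring_display].

Section UnitInterval.
Variable R : realType.

Lemma unitI_ge0 (x : unitI R) : 0 <= val x.
Proof. by have := valP x; rewrite inE /= in_itv /= => /andP[]. Qed.

Lemma unitI_le1 (x : unitI R) : val x <= 1.
Proof. by have := valP x; rewrite inE /= in_itv /= => /andP[]. Qed.

Lemma mem_unitI (x : R) : 0 <= x <= 1 -> x \in `[0%R : R, 1]%classic.
Proof. by move=> x01; rewrite inE /= in_itv. Qed.

Definition I0 : unitI R := Sub 0 (mem_unitI (introT andP (conj (lexx 0) ler01))).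
Definition I1 : unitI R := Sub 1 (mem_unitI (introT andP (conj ler01 (lexx 1)))).

End UnitInterval.
Arguments I0 {R}.
Arguments I1 {R}.

HB.instance Definition _ (R : realType) := isPointed.Build (unitI R) I0.
(* The Borel sigma-algebra of the unit interval: the trace of that of R. *)
HB.instance Definition _ (R : realType) :=
  Measurable.copy (unitI R) (g_sigma_algebra_preimageType (val : unitI R -> R)).

Section BoundedVariation.
Variable R : realType.
Local Notation C := R[i].
Local Notation I := (unitI R).
Implicit Types (f g : I -> C) (s : seq I).

(* Same as [variation] and [variations], which only cover functions R -> R. *)
Definition cvariation f s : R :=
  let F := f \o nth I1 (I0 :: s) in
  \sum_(0 <= n < size s) normc (F n.+1 - F n).

Definition cvariations f : set R :=
  [set cvariation f s | s in [set s | itv_partition I0 I1 s]].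

Definition cvar f : R := sup (cvariations f).

Definition bounded_cvariation f : Prop := has_ubound (cvariations f).

Definition bv_pred : {pred I -> C} := fun f => `[< bounded_cvariation f >].

Fact bv_submod_closed : submod_closed bv_pred.
Proof.
split.
  apply/asboolP; exists 0 => _ [s _ <-].
  rewrite /cvariation big1 // => n _ /=.
  by rewrite subrr; exact: normc0.
move=> a f g /asboolP[Mf ubf] /asboolP[Mg ubg]; apply/asboolP.
exists (normc a * Mf + Mg) => _ [s ps <-].
have hf : cvariation f s <= Mf by apply: ubf; exists s.
have hg : cvariation g s <= Mg by apply: ubg; exists s.
apply: (@le_trans _ _ (normc a * cvariation f s + cvariation g s)).
  rewrite /cvariation mulr_sumr -big_split /=.
  apply: ler_sum => n _.
  rewrite -normcM.
  set A := f _; set B := f _; set A' := g _; set B' := g _.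
  have -> : (a *: f + g) (nth I1 s n) - (a *: f + g) (nth I1 (I0 :: s) n)
    = a * (A - B) + (A' - B').
    by rewrite /A /B /A' /B' !fctE /GRing.scale /=; ring.
  exact: le_normcD.
apply: lerD => //; apply: ler_wpM2l => //.
by rewrite /normc; case: (a) => u v; exact: sqrtr_ge0.
Qed.

End BoundedVariation.

HB.instance Definition _ (R : realType) :=
  GRing.isSubmodClosed.Build _ _ (@bv_pred R) (@bv_submod_closed R).

Section BVspace.
Variable R : realType.

Record BV := MkBV { bv_fun :> unitI R -> R[i]; bv_mem : bv_fun \in @bv_pred R }.

HB.instance Definition _ := [isSub for bv_fun].
HB.instance Definition _ := [Choice of BV by <:].
HB.instance Definition _ := [SubChoice_isSubLmodule of BV by <:].

Definition BV_norm (f : BV) : R := cvar f + sup [set normc (f x) | x in [set: unitI R]].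

Definition null_pred : {pred BV} :=
  fun f => `[< exists2 A : set (unitI R), countable A &
                 forall x, ~ A x -> f x = 0 >].

Fact null_submod_closed : submod_closed null_pred.
Proof.
split; first by apply/asboolP; exists set0 => // x _.
move=> a f g /asboolP[A cA fA] /asboolP[B cB gB]; apply/asboolP.
exists (A `|` B); first last.
  move=> x; rewrite not_orE => -[/fA fx /gB gx].
  have -> : (a *: f + g : BV) x = a * f x + g x by [].
  by rewrite fx gx mulr0 addr0.
rewrite -bigcup2E; apply: bigcup_countable => // -[|[|i]] _ //=.
Qed.

End BVspace.

HB.instance Definition _ (R : realType) :=
  GRing.isSubmodClosed.Build _ _ (@null_pred R) (@null_submod_closed R).

Section BVquotient.
Variable R : realType.
Local Notation C := R[i].

Definition BVhat : Type := Quotient.quot (@null_pred R).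

HB.instance Definition _ := GRing.Zmodule.on BVhat.

Definition BVclass (f : BV R) : BVhat := \pi_(Quotient.quot (@null_pred R)) f.
Definition BVrepr (u : BVhat) : BV R := repr u.

Lemma BVreprK u : BVclass (BVrepr u) = u.
Proof. exact: reprK. Qed.

Lemma BVclass_eq f g : BVclass f = BVclass g <-> f - g \in @null_pred R.
Proof.
split=> [fg|]; last by rewrite Quotient.idealrBE => /eqP.
by rewrite Quotient.idealrBE; apply/eqP.
Qed.

Lemma BVclassD f g : BVclass (f + g) = BVclass f + BVclass g.
Proof. by rewrite /BVclass piE. Qed.

Definition BVhat_scale (a : C) (u : BVhat) : BVhat := BVclass (a *: BVrepr u).

Lemma BVclassZ a f : BVclass (a *: f) = BVhat_scale a (BVclass f).
Proof.
apply/BVclass_eq; rewrite -scalerBr; apply: rpredZ.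
by apply/BVclass_eq; rewrite BVreprK.
Qed.

Fact BVhat_scalerA a b u :
  BVhat_scale a (BVhat_scale b u) = BVhat_scale (a * b) u.
Proof. by rewrite -(BVreprK u) -!BVclassZ scalerA. Qed.

Fact BVhat_scale1r : left_id 1 BVhat_scale.
Proof. by move=> u; rewrite -(BVreprK u) -!BVclassZ scale1r. Qed.

Fact BVhat_scalerDr : right_distributive BVhat_scale +%R.
Proof.
move=> a u v; rewrite -(BVreprK u) -(BVreprK v).
by rewrite -BVclassD -!BVclassZ -BVclassD scalerDr.
Qed.

Fact BVhat_scalerDl u : {morph BVhat_scale^~ u : a b / a + b}.
Proof. by move=> a b; rewrite -(BVreprK u) -!BVclassZ -BVclassD scalerDl. Qed.

HB.instance Definition _ := GRing.Zmodule_isLmodule.Build C BVhat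
  BVhat_scalerA BVhat_scale1r BVhat_scalerDr BVhat_scalerDl.

Definition BVhat_norm (u : BVhat) : R :=
  inf [set BV_norm f | f in [set f | BVclass f = u]].

Definition BVhat_dual : set (BVhat -> C^o) :=
  [set nu | linear nu /\
     exists M : R, forall u, normc (nu u) <= M * BVhat_norm u].

End BVquotient.

Section BetaMap.
Variables (R : realType) (beta : R).
Local Notation C := R[i].
Local Notation I := (unitI R).

Fact beta_map_subproof (x : I) :
  beta * val x - (Num.floor (beta * val x))%:~R \in `[0%R : R, 1]%classic.
Proof.
apply: mem_unitI; have /andP[h1 h2] := floor_itv (beta * val x).
by rewrite subr_ge0 h1 lerBlDl ltW // -[X in _ < _ + X](@mulr1z R) -intrD.
Qed.

Definition beta_map (x : I) : I :=
  Sub (beta * val x - (Num.floor (beta * val x))%:~R) (beta_map_subproof x).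

(* The fibres of [beta_map] are finite when 1 < beta, so that the finitely
   supported sum below is the sum over the whole fibre. *)
Definition PF_fun (f : I -> C) : I -> C :=
  fun x => (beta^-1)%:C * \sum_(y \in [set y | beta_map y = x]) f y.

End BetaMap.

Section PerronFrobenius.
Variables (R : realType) (beta : R) (beta_gt1 : 1 < beta).
Local Notation C := R[i].
Local Notation I := (unitI R).
Implicit Types (f g : I -> C) (x : I) (s : seq I).

Let beta_gt0 : 0 < beta. Proof. exact: lt_trans beta_gt1. Qed.

Let branch (k : nat) x : I := insubd I0 ((val x + k%:R) / beta).
Let valid (k : nat) x := (val x < 1) && ((val x + k%:R) / beta <= 1).
Let n := (Num.trunc beta).+1.

Let val_branch k x : valid k x -> val (branch k x) = (val x + k%:R) / beta.
Proof.
move=> /andP[_ le1]; rewrite val_insubd mem_unitI // le1 andbT.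
by rewrite divr_ge0 ?addr_ge0 ?unitI_ge0 // ltW.
Qed.

Let preimages x := [seq branch k x | k <- iota 0 n & valid k x].

Let preimagesE x : [set y | beta_map beta y = x] = [set` preimages x].
Proof.
apply/seteqP; split => y /=.
  move=> yx; have vx : val x = beta * val y - (Num.floor (beta * val y))%:~R.
    by rewrite -yx.
  have by0 : 0 <= beta * val y by rewrite mulr_ge0 ?unitI_ge0 // ltW.
  have /andP[h1 h2] := floor_itv (beta * val y).
  have k0 : (0 <= Num.floor (beta * val y))%R by rewrite floor_ge0.
  case: (Num.floor (beta * val y)) k0 vx h1 h2 => // k _ vx h1 h2.
  have e : (val x + k%:R) / beta = val y.
    by rewrite vx subrK mulrC mulKf // gt_eqF.
  have v : valid k x.
    rewrite /valid e unitI_le1 andbT vx.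
    by move: h2; rewrite intrD mulr1z => h2; rewrite ltrBlDl.
  apply/mapP; exists k; last by apply: val_inj; rewrite val_branch // e.
  rewrite mem_filter v mem_iota /= add0n ltnS.
  rewrite truncn_ge_nat ?(ltW beta_gt0) //.
  by apply: (le_trans h1); rewrite ler_piMr ?unitI_le1 // ltW.
move=> /mapP[k]; rewrite mem_filter => /andP[v _] ->.
apply: val_inj => /=; rewrite val_branch // mulrCA mulfV ?gt_eqF // mulr1.
rewrite (@floor_def _ _ k%:Z); first by rewrite addrK.
have /andP[x1 _] := v.
rewrite -[k%:~R]/(k%:R) lerDr unitI_ge0 /= intrD mulr1z addrC.
by rewrite ltrD2l.
Qed.

Let uniq_preimages x : uniq (preimages x).
Proof.
rewrite map_inj_in_uniq ?filter_uniq ?iota_uniq //.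
move=> j k; rewrite !mem_filter => /andP[vj _] /andP[vk _] /(congr1 val).
rewrite !val_branch // => /divIf; rewrite gt_eqF // => /(_ isT) /addrI /eqP.
by rewrite eqr_nat => /eqP.
Qed.

Let term f (k : nat) x : C := if valid k x then f (branch k x) else 0.

Let PF_funE f :
  PF_fun beta f = (beta^-1)%:C *: \sum_(k < n) term f k.
Proof.
apply/funext => x; rewrite /PF_fun preimagesE -fsbig_seq //.
rewrite big_map big_filter big_mkcond /= fctE /GRing.scale /=.
by rewrite fct_sumE -(big_mkord xpredT (fun k => term f k x)).
Qed.

Let csum f := fix csum x s {struct s} : R :=
  if s is y :: s' then normc (f y - f x) + csum y s' else 0.

Let normc_ge0 (z : C) : 0 <= normc z.
Proof. by case: z => u v; exact: sqrtr_ge0. Qed.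

Let cvariationE f s : cvariation f s = csum f I0 s.
Proof.
rewrite /cvariation; elim: s I0 => [x|y s ih x] /=; first by rewrite big_nil.
by rewrite big_nat_recl //= -ih.
Qed.

Let csum_cat f x s t : csum f x (s ++ t) = csum f x s + csum f (last x s) t.
Proof. by elim: s x => [x|y s ih x] /=; rewrite ?add0r // ih addrA. Qed.

Let csum_ge0 f x s : 0 <= csum f x s.
Proof. by elim: s x => // y s ih x /=; exact: addr_ge0. Qed.

Let I0_le x : (I0 <= x)%O.
Proof. by rewrite leEsub; exact: unitI_ge0. Qed.

Let le_I1 x : (x <= I1)%O.
Proof. by rewrite leEsub; exact: unitI_le1. Qed.

Let csum_le f M : ubound (cvariations f) M ->
  forall x s, path <%O x s -> csum f x s <= M.
Proof.
move=> ubM x s xs.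
have h t : path <%O I0 t -> csum f I0 t <= M.
  move=> pt; have [l1|l1] := eqVneq (last I0 t) I1.
    by apply: ubM; exists t; [split => //; exact/eqP|exact: cvariationE].
  apply: (@le_trans _ _ (csum f I0 (rcons t I1))).
    by rewrite -cats1 csum_cat lerDl csum_ge0.
  apply: ubM; exists (rcons t I1); last exact: cvariationE.
  by split; [rewrite rcons_path pt /= lt_neqAle l1 le_I1|rewrite last_rcons].
have [x0|x0] := eqVneq x I0; first by rewrite x0; apply: h; rewrite -x0.
apply: (@le_trans _ _ (csum f I0 (x :: s))); first by rewrite lerDr normc_ge0.
by apply: h; rewrite /= xs andbT lt_neqAle eq_sym x0 I0_le.
Qed.

Let term_bounded_cvariation f k :
  bounded_cvariation f -> bounded_cvariation (term f k).
Proof.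
move=> [M ubM].
have normfB : exists B, forall x, normc (f x) <= B.
  exists (M + normc (f I0)) => x.
  have [->|x0] := eqVneq x I0.
    by rewrite lerDr; exact: (csum_le ubM (x := I0) (s := [::])).
  have -> : f x = (f x - f I0) + f I0 by rewrite subrK.
  apply: (le_trans (le_normcD _ _)); rewrite lerD2r.
  have := csum_le ubM (x := I0) (s := [:: x]); rewrite /= addr0 andbT.
  by apply; rewrite lt_neqAle eq_sym x0 I0_le.
have {normfB}[B hB] := normfB.
have valid_le x y : (x <= y)%O -> valid k y -> valid k x.
  rewrite leEsub => xy /andP[y1 y2]; rewrite /valid (le_lt_trans xy y1) /=.
  by apply: le_trans y2; rewrite ler_pM2r ?invr_gt0 // lerD2r.
have branch_lt x y : (x < y)%O -> valid k x -> valid k y ->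
    (branch k x < branch k y)%O.
  rewrite !ltEsub => xy vx vy; rewrite !val_branch //.
  by rewrite ltr_pM2r ?invr_gt0 // ltrD2r.
have csum0 x s : path <%O x s -> ~~ valid k x -> csum (term f k) x s = 0.
  elim: s x => //= y s ih x /andP[xy ys] vx.
  have vy : ~~ valid k y by apply: contra vx; apply: valid_le; exact: ltW.
  rewrite ih // addr0 /term (negbTE vx) (negbTE vy) subrr; exact: normc0.
have B0 : 0 <= B := le_trans (normc_ge0 _) (hB I0).
have main s x : path <%O x s -> valid k x ->
    exists2 t, path <%O (branch k x) t &
      csum (term f k) x s <= csum f (branch k x) t + B.
  elim: s x => /= [x _ _|y s ih x /andP[xy ys] vx].
    by exists [::] => //=; rewrite add0r.
  have [vy|vy] := boolP (valid k y).
    have [t pt lt] := ih _ ys vy; exists (branch k y :: t).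
      by rewrite /= branch_lt.
    by rewrite /= /term vx vy -addrA lerD2l.
  exists [::] => //=; rewrite csum0 // addr0 add0r /term vx (negbTE vy) sub0r.
  by rewrite normcN.
exists (M + B) => _ [s [ps _] <-]; rewrite cvariationE.
have [v0|v0] := boolP (valid k I0).
  have [t pt] := main _ _ ps v0; move/le_trans; apply.
  by rewrite lerD2r; exact: csum_le pt.
rewrite csum0 // addr_ge0 //.
exact: (csum_le ubM (x := I0) (s := [::])).
Qed.

Fact PF_fun_bv f : f \in @bv_pred R -> PF_fun beta f \in @bv_pred R.
Proof.
move=> /asboolP fbv; rewrite PF_funE; apply: rpredZ; apply: rpred_sum => k _.
by apply/asboolP; exact: term_bounded_cvariation.
Qed.

Fact PF_fun_linear a f g :
  PF_fun beta (a *: f + g) = a *: PF_fun beta f + PF_fun beta g.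
Proof.
have -> : PF_fun beta (a *: f + g) =
    (beta^-1)%:C *: (a *: (\sum_(k < n) term f k) + \sum_(k < n) term g k).
  rewrite PF_funE; congr (_ *: _); rewrite scaler_sumr -big_split /=.
  apply: eq_bigr => k _; apply/funext => x; rewrite !fctE /term /GRing.scale /=.
  by case: ifP => // _; rewrite mulr0 addr0.
by rewrite !PF_funE scalerDr !scalerA mulrC.
Qed.

Definition PF_BV (f : BV R) : BV R := MkBV (PF_fun_bv (bv_mem f)).

Fact PF_BV_linear : linear PF_BV.
Proof. by move=> a f g; apply: val_inj; exact: PF_fun_linear. Qed.

HB.instance Definition _ :=
  GRing.isLinear.Build C (BV R) (BV R) *:%R PF_BV PF_BV_linear.

Fact PF_BV_null (f : BV R) : f \in @null_pred R -> PF_BV f \in @null_pred R.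
Proof.
move=> /asboolP[A cA fA]; apply/asboolP; exists (beta_map beta @` A).
  exact: sub_countable (card_image_le _ _) cA.
move=> x nx; rewrite /= /PF_fun fsbig1 ?mulr0 // => y yx.
by apply: fA => Ay; apply: nx; exists y.
Qed.

(* Independent of the choice of representatives: see [PF_class]. *)
Definition PF (u : BVhat R) : BVhat R := BVclass (PF_BV (BVrepr u)).

Lemma PF_class (f : BV R) : PF (BVclass f) = BVclass (PF_BV f).
Proof.
apply/BVclass_eq; rewrite -raddfB; apply: PF_BV_null.
by apply/BVclass_eq; rewrite BVreprK.
Qed.

Fact PF_linear : linear PF.
Proof.
move=> a u v; rewrite -(BVreprK u) -(BVreprK v) -[a *: _]BVclassZ -BVclassD.
by rewrite !PF_class linearP BVclassD BVclassZ.
Qed.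

HB.instance Definition _ :=
  GRing.isLinear.Build C (BVhat R) (BVhat R) *:%R PF PF_linear.

Definition PF_dual (nu : BVhat R -> C^o) : BVhat R -> C^o := nu \o PF.

Definition PF_eigenvalue (lambda : C) : Prop :=
  exists2 u : BVhat R, u != 0 & PF u = lambda *: u.

Definition nonleading_eigenvalue (lambda : C) : Prop :=
  [/\ PF_eigenvalue lambda, lambda != 1 & beta^-1 < normc lambda].

Definition PF_eigenfunctional (lambda : C) (nu : BVhat R -> C^o) : Prop :=
  [/\ BVhat_dual nu, nu != 0 & PF_dual nu = lambda *: nu].

End PerronFrobenius.

Section ComplexMeasure.
Local Open Scope ereal_scope.

Record complex_measure d (T : measurableType d) (R : realType) :=
  ComplexMeasure {
    cmeas :> set T -> R[i]^o ;
    cmeas0 : cmeas set0 = 0%R ;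
    cmeas_sigma_additive : forall F : (set T)^nat,
      (forall k, measurable (F k)) -> trivIset setT F ->
      (fun n => \sum_(0 <= k < n) cmeas (F k))%R @ \oo
        --> cmeas (\bigcup_k F k) }.

Arguments cmeas_sigma_additive {d T R} m [F] _ _ : rename.

Context d (T : measurableType d) (R : realType).
Implicit Types (m : complex_measure T R) (nu : {charge set T -> \bar R}).
Local Notation C := R[i].

Definition cmeas_Re m : set T -> \bar R := fun A => (complex.Re (m A))%:E.
Definition cmeas_Im m : set T -> \bar R := fun A => (complex.Im (m A))%:E.

Let sigma_additive_comp (h : C -> R) m :
    {morph h : x y / (x - y)%R} -> (forall z, `|h z|%:C <= `|z|)%R ->
  semi_sigma_additive (fun A => (h (m A))%:E).
Proof.
move=> hB hle F mF tF mUF.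
have h0 : h 0%R = 0%R by rewrite -(subrr 0%R) hB subrr.
have hN x : h (- x)%R = (- h x)%R by rewrite -sub0r hB h0 sub0r.
have hD x y : h (x + y)%R = (h x + h y)%R by rewrite -{1}[y]opprK hB hN opprK.
have /cvgrPdist_lt cm := cmeas_sigma_additive m mF tF.
rewrite (_ : (fun n => _) = EFin \o (fun n => h (\sum_(0 <= k < n) m (F k))%R)).
  apply: cvg_EFin; first exact: nearW.
  apply/cvgrPdist_lt => e e0.
  have e0C : (0 < e%:C :> C)%R by rewrite ltcR.
  have := cm _ e0C; apply: filterS => n /= lt_e.
  rewrite -hB -ltcR; apply: le_lt_trans lt_e; exact: hle.
apply/funext => n /=; rewrite (big_morph h hD h0) -sumEFin //.
Qed.

Let normc_Re (z : C) : (`|complex.Re z|%:C <= `|z|)%R.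
Proof. exact: normc_ge_Re. Qed.

Let normc_Im (z : C) : (`|complex.Im z|%:C <= `|z|)%R.
Proof.
have := normc_ge_Re (z * 'i)%R; rewrite ReiNIm normrN normrM.
suff -> : `|'i : C|%R = 1%R by rewrite mulr1.
by rewrite normc_def /= expr0n add0r expr1n sqrtr1.
Qed.

Let cmeas_Re_sigma_additive m : semi_sigma_additive (cmeas_Re m).
Proof. by apply: sigma_additive_comp => // -[? ?] [? ?]. Qed.

Let cmeas_Im_sigma_additive m : semi_sigma_additive (cmeas_Im m).
Proof. by apply: sigma_additive_comp => // -[? ?] [? ?]. Qed.

Let cmeas_Re0 m : cmeas_Re m set0 = 0.
Proof. by rewrite /cmeas_Re cmeas0. Qed.

Let cmeas_Im0 m : cmeas_Im m set0 = 0.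
Proof. by rewrite /cmeas_Im cmeas0. Qed.

HB.instance Definition _ m := isCharge.Build d T R (cmeas_Re m)
  (cmeas_Re0 m) (fun _ _ => isT) (@cmeas_Re_sigma_additive m).
HB.instance Definition _ m := isCharge.Build d T R (cmeas_Im m)
  (cmeas_Im0 m) (fun _ _ => isT) (@cmeas_Im_sigma_additive m).

(* The value does not depend on the Hahn decomposition that [cid] picks. *)
Definition charge_integral nu (f : T -> R) : R :=
  let nuPN := projT2 (cid (projT2 (cid (Hahn_decomposition nu)))) in
  (\int[jordan_pos nuPN]_x f x - \int[jordan_neg nuPN]_x f x)%R.

Definition cintegral m (f : T -> C) : C :=
  ((charge_integral (cmeas_Re m) (fun x => complex.Re (f x))
    - charge_integral (cmeas_Im m) (fun x => complex.Im (f x)))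
   +i* (charge_integral (cmeas_Re m) (fun x => complex.Im (f x))
    + charge_integral (cmeas_Im m) (fun x => complex.Re (f x))))%R.

End ComplexMeasure.

(* Main.v *)
Require Import Defs.
From mathcomp Require Import all_boot all_order all_algebra.
From mathcomp Require Import all_classical all_reals all_analysis.
From mathcomp Require Import complex ring lra.

(** Write [tau] for the beta-map and suppose that [nu], an eigenfunctional for
    [lambda], is integration against a complex measure [m].  Everything is read
    off the distribution function [F x = nu (1_[0,x]) = m ([0,x])].

    The transfer operator sends the indicator of [[0,x]], with
    [beta x = k + t], to [1/beta (k 1_[0,1] + 1_[0,t])], up to finitely many
    points, which the quotient space ignores.  Hence
    [beta lambda F ((k + t) / beta) = k F 1 + F t] ([PF_BVstep]): on each branch
    of [tau], [F] is a copy of itself on [[0,1]] (a part of it, on an incomplete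
    branch) shrunk by [beta lambda], a number of modulus [mu > 1].

    Three comparisons rest on one maximum principle ([ge0_of_expansion]): if
    [g] is bounded below and [g (tau x) <= mu g x] with [mu > 1], then
    [0 <= g], because [inf g / mu <= inf g].
    - Taking [g = - |F|] when [F 1 = 0]: then [F = 0] ([scaling_vanish]).
    - Taking [g x = |F 1| x - |F x|] when [1 <= |lambda|]: then
      [|F x| <= |F 1| x], and the scaling relation at [1] is an equality case of
      the triangle inequality, which forces [lambda = 1]
      ([scaling_unimodular]).
    - Taking [g x = V x - V 1 x], where [V x] is the total variation of [F] on
      [[0,x]], when [F 1 <> 0]: the variation is additive over the branches, so
      [mu V ((k + t) / beta) >= k V 1 + V t], whence [V x >= V 1 x]; the
      scaling relation at [1] then gives [mu >= beta], that is [1 <= |lambda|]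
      ([scaling_not_contracting]).

    So [lambda <> 1] leaves only [F = 0].  This is where the measure matters: for
    an arbitrary functional [F] may have infinite variation, and then the third
    comparison says nothing, whereas the Jordan decomposition of [m] bounds the
    variation ([cmeas_increments]).  Finally [F = 0] makes
    all integrals against [m] vanish, because the intervals [[0,x]] determine
    a finite measure ([charge_integral_vanish]); then [nu = 0], which an
    eigenfunctional is not. *)

Set Implicit Arguments.
Unset Strict Implicit.
Unset Printing Implicit Defensive.

Import Order.TTheory GRing.Theory Num.Theory.
Import ComplexField.Normc.
Local Open Scope classical_set_scope.
Local Open Scope ring_scope.
Local Open Scope complex_scope.

(** * Functions of bounded variation that scale under the beta-map *)

Section Scaling.
Variables (R : realType) (beta : R).
Hypothesis beta_gt1 : 1 < beta.
Local Notation C := R[i].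

Let beta_gt0 : 0 < beta. Proof. exact: lt_trans beta_gt1. Qed.

Lemma normc_ge0 (z : C) : 0 <= normc z.
Proof. by case: z => a b; exact: sqrtr_ge0. Qed.

Lemma normc_real (x : R) : 0 <= x -> normc x%:C = x.
Proof. by move=> x0; rewrite /normc /= expr0n addr0 sqrtr_sqr ger0_norm. Qed.

Lemma normc_nat k : normc (k%:R : C) = k%:R.
Proof. by rewrite -(normc_real (ler0n R k)) rmorph_nat. Qed.

(** The inverse branches of the beta-map are [t |-> (k + t) / beta]; handling
    them through [k] and [t] avoids integer parts in all that follows. *)
Lemma branch_decomp x : 0 <= x -> x <= 1 -> exists k t,
  [/\ 0 <= t, t < 1, (k%:R + t <= beta) & x = (k%:R + t) / beta].
Proof.
move=> x0 x1; have bx0 : 0 <= beta * x by rewrite mulr_ge0 // ltW.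
have /andP[h1 h2] := truncn_itv bx0.
exists (Num.trunc (beta * x)), (beta * x - (Num.trunc (beta * x))%:R).
rewrite subr_ge0 h1 ltrBlDl -natr1 in h2 *; split => //.
- by rewrite addrC subrK ler_piMr // ltW.
- by rewrite addrC subrK mulrC mulKf // gt_eqF.
Qed.

Lemma branch_in01 (k : nat) t : 0 <= t -> k%:R + t <= beta ->
  0 <= (k%:R + t) / beta <= 1.
Proof.
move=> t0 ktb; rewrite divr_ge0 ?addr_ge0 ?ler0n ?(ltW beta_gt0) //=.
by rewrite ler_pdivrMr // mul1r.
Qed.

(** A maximum principle: with [x] the preimage of [t], the hypothesis reads
    [inf g / mu <= g x] for all [x], so [inf g / mu <= inf g], which for
    [1 < mu] excludes a negative infimum. *)
Lemma ge0_of_expansion (mu B : R) (g : R -> R) : 1 < mu ->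
    (forall x, 0 <= x <= 1 -> B <= g x) ->
    (forall (k : nat) t, 0 <= t -> t <= 1 -> k%:R + t <= beta ->
      g t <= mu * g ((k%:R + t) / beta)) ->
  forall x, 0 <= x <= 1 -> 0 <= g x.
Proof.
move=> mu1 Bg gmu.
pose S := g @` [set x | 0 <= x <= 1].
have S0 : S !=set0 by exists (g 0), 0 => //=; rewrite lexx ler01.
have lbS : has_lbound S by exists B => _ [x x01 <-]; exact: Bg.
have mu0 : 0 < mu by exact: lt_trans mu1.
have hS : inf S / mu <= inf S.
  apply: lb_le_inf => // _ [x /andP[x0 x1] <-].
  have [k [t [t0 t1 ktb ->]]] := branch_decomp x0 x1.
  rewrite ler_pdivrMr // mulrC (le_trans _ (gmu _ _ t0 (ltW t1) ktb)) //.
  by apply: inf_lbound => //; exists t => //=; rewrite t0 ltW.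
have infS0 : 0 <= inf S.
  rewrite leNgt; apply/negP => S_lt0; move: hS.
  by rewrite ler_pdivrMr // leNgt -{2}[inf S]mulr1 ltr_nM2l // mu1.
by move=> x x01; apply: (le_trans infS0); apply: inf_lbound => //; exists x.
Qed.

(** Bounded variation of [F] on [[0, c]] amounts to the existence of such an
    [M]: the variation function of [F] is the least one.  Majorants are easier
    to cut and rescale than partitions. *)
Definition dominates_increments (F : R -> C) (c : R) (M : R -> R) :=
  forall x y, 0 <= x -> x <= y -> y <= c -> normc (F y - F x) <= M y - M x.

Lemma dominates_increments_le F c M x : dominates_increments F c M ->
  0 <= x <= c -> normc (F x - F 0) <= M c - M 0.
Proof.
move=> domM /andP[x0 xc].
have h1 := domM 0 x (lexx 0) x0 xc.
have h2 := domM x c x0 xc (lexx c).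
have := normc_ge0 (F c - F x); lra.
Qed.

Variables (lambda : C) (F : R -> C).
Hypothesis mu_gt1 : 1 < beta * normc lambda.
Hypothesis F0 : F 0 = 0.
Hypothesis F_scaling : forall (k : nat) t,
  0 <= t -> t <= 1 -> k%:R + t <= beta ->
  beta%:C * lambda * F ((k%:R + t) / beta) = k%:R * F 1 + F t.

Let mu := beta * normc lambda.

Let normc_mu z : normc (beta%:C * lambda * z) = mu * normc z.
Proof. by rewrite 2!normcM normc_real // ltW. Qed.

(** A vanishing total mass [F 1] removes the sum over full branches, leaving
    [mu |F x| = |F (tau x)|] with [F] bounded. *)
Lemma scaling_vanish M : dominates_increments F 1 M -> F 1 = 0 ->
  forall x, 0 <= x <= 1 -> F x = 0.
Proof.
move=> domM F1 x x01; apply: eq0_normc; apply/eqP.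
rewrite eq_le normc_ge0 andbT -oppr_ge0.
apply: (@ge0_of_expansion mu (- (M 1 - M 0)) (fun x => - normc (F x))) x01 => //.
- move=> y y01; rewrite lerN2.
  by have := dominates_increments_le domM y01; rewrite F0 subr0.
- move=> k t t0 t1 ktb.
  by rewrite mulrN -normc_mu F_scaling // F1 mulr0 add0r.
Qed.

(** Once [|F x| <= |F 1| x] is known, write [beta = k + t].  The scaling
    relation at [1] becomes [beta lambda = k + z] with [|z| <= t], while
    [|beta lambda| >= k + t]; as [k > 0], only [z = t] is possible. *)
Lemma scaling_unimodular M : dominates_increments F 1 M -> F 1 != 0 ->
  1 <= normc lambda -> lambda = 1.
Proof.
move=> domM F1 lambda_ge1.
have F_le x : 0 <= x <= 1 -> normc (F x) <= normc (F 1) * x.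
  move=> x01; rewrite -subr_ge0.
  apply: (@ge0_of_expansion beta (- (M 1 - M 0))
    (fun x => normc (F 1) * x - normc (F x))) x01 => //.
  - move=> y y01; have := dominates_increments_le domM y01; rewrite F0 subr0.
    have : 0 <= normc (F 1) * y.
      by rewrite mulr_ge0 ?normc_ge0 //; case/andP: y01.
    lra.
  - move=> k t t0 t1 ktb; set y := _ / beta.
    have yE : beta * y = k%:R + t by rewrite /y mulrCA mulfV ?mulr1 // gt_eqF.
    have h1 : mu * normc (F y) <= normc (F 1) * k%:R + normc (F t).
      rewrite -normc_mu F_scaling //; apply: (le_trans (le_normcD _ _)).
      by rewrite normcM normc_nat mulrC.
    have h2 : beta * normc (F y) <= mu * normc (F y).
      by rewrite /mu ler_wpM2r ?normc_ge0 // ler_peMr // ltW.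
    rewrite mulrBr mulrCA yE mulrDr; lra.
have [k [t [t0 t1 ktb oneE]]] := branch_decomp ler01 (lexx 1).
have betaE : beta = k%:R + t.
  by move/(congr1 ( *%R^~ beta)): oneE; rewrite mul1r divfK // gt_eqF.
have := F_scaling t0 (ltW t1) ktb; rewrite -oneE => scal1.
have nF1 : 0 < normc (F 1).
  rewrite lt_neqAle normc_ge0 andbT eq_sym.
  by apply: contra F1 => /eqP/eq0_normc ->.
(* the ratio turns the scaling relation at 1 into beta lambda = k + z *)
pose z := F t / F 1.
have z_le : normc z <= t.
  rewrite normcM normcV ler_pdivrMr // mulrC F_le // t0 ltW //.
have bz : beta%:C * lambda = k%:R + z.
  by apply: (mulIf F1); rewrite scal1 mulrDl divfK.
have kz : k%:R + t <= normc (k%:R + z).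
  rewrite -bz normcM normc_real ?(ltW beta_gt0) // -betaE.
  by rewrite ler_peMr // ltW.
have k_gt0 : 0 < k%:R :> R.
  by rewrite ltr0n; case: (k) betaE => // betaE; move: beta_gt1; lra.
have zE : z = t%:C.
  move: z_le kz; rewrite -(rmorph_nat (real_complex R)).
  case: z {bz} => a b /= z_le kz.
  have sz : a ^+ 2 + b ^+ 2 <= t ^+ 2.
    rewrite -[leLHS]sqr_sqrtr ?addr_ge0 ?sqr_ge0 //.
    by rewrite ler_sqr ?nnegrE // sqrtr_ge0.
  have skz : (k%:R + t) ^+ 2 <= (k%:R + a) ^+ 2 + (0 + b) ^+ 2.
    rewrite -[leRHS]sqr_sqrtr ?addr_ge0 ?sqr_ge0 //.
    by rewrite ler_sqr ?nnegrE ?sqrtr_ge0 // addr_ge0 // ltW.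
  have ta : t <= a by rewrite -(ler_pM2l k_gt0); lra.
  have b0 : b ^+ 2 = 0.
    by apply/eqP; rewrite eq_le sqr_ge0 andbT; nra.
  have aE : a = t by apply/eqP; rewrite eq_le ta andbT; nra.
  by move/eqP: b0; rewrite sqrf_eq0 => /eqP ->; rewrite aE.
have bC : beta%:C != 0 :> C by rewrite -(rmorph0 (real_complex R)) (inj_eq (@complexI R)) gt_eqF.
apply: (mulfI bC); rewrite mulr1 bz zE -(rmorph_nat (real_complex R)).
by rewrite betaE rmorphD.
Qed.

(** The total variation of [F] on [[0, c]], obtained from above. *)
Definition increment_variation (c : R) : R :=
  inf [set M c - M 0 | M in dominates_increments F c].

Let V := increment_variation.

Let V_le c M : 0 <= c -> dominates_increments F c M -> V c <= M c - M 0.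
Proof.
move=> c0 domM; apply: inf_lbound; last by exists M.
exists 0 => _ [M' domM' <-].
by apply: (le_trans (normc_ge0 (F c - F 0))); exact: domM'.
Qed.

Let le_V M c a : dominates_increments F 1 M -> 0 <= c <= 1 ->
  (forall M', dominates_increments F c M' -> a <= M' c - M' 0) -> a <= V c.
Proof.
move=> domM /andP[c0 c1] aM; apply: lb_le_inf.
  by exists (M c - M 0), M => // x y x0 xy yc; apply: domM => //; exact: le_trans c1.
by move=> _ [M' domM' <-]; exact: aM.
Qed.

(** A majorant of [F] on a branch, rescaled by [mu], is a majorant of [F] on
    [[0, t]], since the branch carries a copy of [F]. *)
Let V_piece M (k : nat) t c : 0 <= t <= 1 -> k%:R + t <= beta ->
  (k%:R + t) / beta <= c -> dominates_increments F c M ->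
  V t <= mu * (M ((k%:R + t) / beta) - M (k%:R / beta)).
Proof.
move=> /andP[t0 t1] ktb ktc domM.
rewrite mulrBr -{2}[k%:R]addr0.
apply: (@V_le t (fun u => mu * M ((k%:R + u) / beta))) => // x y x0 xy yt.
have yb : k%:R + y <= beta by apply: le_trans ktb; rewrite lerD2l.
have xb : k%:R + x <= beta by apply: le_trans yb; rewrite lerD2l.
have y1 : y <= 1 := le_trans yt t1.
have -> : F y - F x = beta%:C * lambda *
    (F ((k%:R + y) / beta) - F ((k%:R + x) / beta)).
  rewrite mulrBr !F_scaling //; [ring|exact: le_trans y1|exact: le_trans xy].
rewrite normc_mu -mulrBr ler_pM2l; last exact: lt_trans mu_gt1.
apply: domM.
- by rewrite divr_ge0 ?addr_ge0 // ltW.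
- by rewrite ler_pM2r ?invr_gt0 // lerD2l.
- by apply: le_trans ktc; rewrite ler_pM2r ?invr_gt0 // lerD2l.
Qed.

(** Adding up the pieces: the [k] full branches below [(k + t) / beta] carry
    [V 1 / mu] each, the last one [V t / mu]. *)
Let V_superadditive M (k : nat) t : dominates_increments F 1 M ->
  0 <= t <= 1 -> k%:R + t <= beta ->
  k%:R * V 1 + V t <= mu * V ((k%:R + t) / beta).
Proof.
move=> domM t01 ktb.
have mu0 : 0 < mu by exact: lt_trans mu_gt1.
have t0 : 0 <= t by case/andP: t01.
rewrite -ler_pdivrMl //; apply: (le_V domM); first exact: branch_in01.
move=> M' domM'; rewrite ler_pdivrMl //.
have full j : (j <= k)%N -> j%:R * V 1 <= mu * (M' (j%:R / beta) - M' 0).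
  elim: j => [|j ih] jk; first by rewrite !mul0r subrr mulr0.
  have jk' : j%:R + 1 <= k%:R + t :> R.
    by rewrite natr1 -[leLHS]addr0 lerD // ler_nat.
  have := @V_piece M' j 1 ((k%:R + t) / beta).
  rewrite ler01 lexx (le_trans jk' ktb) ler_pM2r ?invr_gt0 // jk' natr1.
  move=> /(_ isT isT isT domM').
  have := ih (ltnW jk); rewrite -natr1; lra.
have := full k (leqnn k); have := V_piece t01 ktb (lexx _) domM'; lra.
Qed.

(** If [mu < beta], the superadditivity of [V] makes [V x - V 1 x] expand by
    [mu], so [V x >= V 1 x]; then superadditivity at [1] yields
    [mu V 1 >= beta V 1], a contradiction as [V 1 >= |F 1| > 0]. *)
Lemma scaling_not_contracting M : dominates_increments F 1 M -> F 1 != 0 ->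
  1 <= normc lambda.
Proof.
move=> domM F1.
have V1_gt0 : 0 < V 1.
  apply: (@lt_le_trans _ _ (normc (F 1 - F 0))); last first.
    apply: (le_V domM) => [|M' domM']; first by rewrite ler01 lexx.
    by apply: domM'; rewrite ?ler01.
  rewrite F0 subr0 lt_neqAle normc_ge0 andbT eq_sym.
  by apply: contra F1 => /eqP/eq0_normc ->.
have V_ge0 x : 0 <= x <= 1 -> 0 <= V x.
  move=> x01; apply: (le_V domM) => // M' domM'.
  apply: le_trans (normc_ge0 (F x - F 0)) _; apply: domM' => //.
  by case/andP: x01.
rewrite leNgt; apply/negP => lambda_lt1.
have mu_lt : mu < beta by rewrite /mu gtr_pMr.
have V_ge x : 0 <= x <= 1 -> 0 <= V x - V 1 * x.
  apply: (@ge0_of_expansion mu (- V 1) (fun x => V x - V 1 * x)) => //.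
    move=> y y01; have := V_ge0 y y01.
    have : V 1 * y <= V 1 by rewrite ler_piMr ?(ltW V1_gt0) //; case/andP: y01.
    lra.
  move=> k t t0 t1 ktb; set y := _ / beta.
  have yE : beta * y = k%:R + t by rewrite /y mulrCA mulfV ?mulr1 // gt_eqF.
  have y0 : 0 <= y by case/andP: (branch_in01 t0 ktb).
  have := @V_superadditive M k t domM; rewrite t0 t1 ktb => /(_ isT isT).
  have : mu * (V 1 * y) <= V 1 * (k%:R + t).
    by rewrite -yE mulrCA ler_pM2l // ler_wpM2r // ltW.
  rewrite -/y; lra.
have [k [t [t0 t1 ktb oneE]]] := branch_decomp ler01 (lexx 1).
have betaE : beta = k%:R + t.
  by move/(congr1 ( *%R^~ beta)): oneE; rewrite mul1r divfK // gt_eqF.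
have := @V_superadditive M k t domM; rewrite t0 (ltW t1) ktb -oneE.
move=> /(_ isT isT); have := V_ge t; rewrite t0 (ltW t1) => /(_ isT).
have : mu * V 1 < beta * V 1 by rewrite ltr_pM2r.
rewrite betaE; lra.
Qed.

Lemma scaling_trivial M : dominates_increments F 1 M -> lambda != 1 ->
  forall x, 0 <= x <= 1 -> F x = 0.
Proof.
move=> domM lambda1; apply: (scaling_vanish domM).
apply/eqP/negPn/negP => F1; move/eqP: lambda1; apply.
by apply: (scaling_unimodular domM F1); exact: scaling_not_contracting domM F1.
Qed.

End Scaling.

(** * Integration against a charge or a complex measure *)

Section ChargeIntegral.
Context d (T : measurableType d) (R : realType).

(** The chosen Hahn decomposition enters only here: any pair of finite measures
    with these two properties serves in the sequel. *)
Lemma charge_integralE (rho : {charge set T -> \bar R}) :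
  exists p n : {finite_measure set T -> \bar R},
    (forall A, measurable A -> rho A = (p A - n A)%E) /\
    (forall f, charge_integral rho f =
       Rintegral p setT f - Rintegral n setT f).
Proof.
pose nuPN := projT2 (cid (projT2 (cid (Hahn_decomposition rho)))).
exists (jordan_pos nuPN), (jordan_neg nuPN); split => [A mA|f].
  by rewrite (jordan_decomp nuPN mA) /cadd /= cscaleN1.
by [].
Qed.

Lemma charge_integral_indic (rho : {charge set T -> \bar R}) A :
  measurable A -> charge_integral rho \1_A = fine (rho A).
Proof.
move=> mA; have [p [n [rhoE ->]]] := charge_integralE rho.
rewrite rhoE // fineB ?fin_num_measure //.
by rewrite /Rintegral !integral_indic // setIT.
Qed.

Lemma charge_integral0 (rho : {charge set T -> \bar R}) :
  charge_integral rho (fun=> 0) = 0.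
Proof.
have [p [n [_ ->]]] := charge_integralE rho.
by rewrite /Rintegral !integral0 subrr.
Qed.

Lemma cintegral_indic (m : complex_measure T R) A : measurable A ->
  cintegral m (fun x => (\1_A x)%:C) = m A.
Proof.
move=> mA; rewrite /cintegral /= !charge_integral_indic // !charge_integral0.
by rewrite subr0 add0r /cmeas_Re /cmeas_Im /=; case: (m A).
Qed.

(** The total variation measure bounds the increments of a charge. *)
Lemma charge_increments (rho : {charge set T -> \bar R}) :
  exists M : set T -> R, forall A B, measurable A -> measurable B ->
    A `<=` B -> `|fine (rho B) - fine (rho A)| <= M B - M A.
Proof.
have [p [n [rhoE _]]] := charge_integralE rho.
exists (fun A => fine (p A) + fine (n A)) => A B mA mB AB.
rewrite !rhoE // !fineB ?fin_num_measure //.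
have pAB : fine (p A) <= fine (p B).
  by rewrite fine_le ?fin_num_measure // le_measure ?inE.
have nAB : fine (n A) <= fine (n B).
  by rewrite fine_le ?fin_num_measure // le_measure ?inE.
by rewrite ler_norml; lra.
Qed.

Lemma cmeas_increments (m : complex_measure T R) :
  exists M : set T -> R, forall A B, measurable A -> measurable B ->
    A `<=` B -> normc (m B - m A) <= M B - M A.
Proof.
have [M1 M1P] := charge_increments (cmeas_Re m).
have [M2 M2P] := charge_increments (cmeas_Im m).
exists (fun A => M1 A + M2 A) => A B mA mB AB.
have := M1P A B mA mB AB; have := M2P A B mA mB AB.
rewrite /cmeas_Re /cmeas_Im /=; case: (m B) (m A) => [a b] [a' b'] /= h1 h2.
apply: (@le_trans _ _ (`|a - a'| + `|b - b'|)); last by lra.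
rewrite -[leRHS]ger0_norm ?addr_ge0 // -sqrtr_sqr ler_wsqrtr //.
rewrite [leRHS]sqrrD !real_normK ?num_real // lerD2r lerDl mulrn_wge0 // mulr_ge0.
Qed.

End ChargeIntegral.

Section InitialIntervals.
Variable R : realType.

Definition initial (x : R) : set (unitI R) := [set y | val y <= x].

Lemma measurable_initial x : measurable (initial x).
Proof.
exists `]-oo, x]%classic; first exact: measurable_itv.
by rewrite setTI; apply/seteqP; split => y /=; rewrite in_itv.
Qed.

Lemma initial_le (x y : R) : x <= y -> initial x `<=` initial y.
Proof. by move=> xy z /= zx; exact: le_trans zx xy. Qed.

(** The two Jordan parts agree on the intervals [[0, x]], hence on differences
    of these, which form a pi-system generating the Borel sets; so they are
    equal and their integrals cancel. *)
Lemma charge_integral_vanish (rho : {charge set (unitI R) -> \bar R}) :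
  (forall x, 0 <= x <= 1 -> rho (initial x) = 0%E) ->
  forall f, charge_integral rho f = 0.
Proof.
move=> rho0 f; have [p [n [rhoE ->]]] := charge_integralE rho.
have mval : measurable_fun setT (val : unitI R -> R).
  by move=> _ B mB; exists B.
have pn_initial x : p (initial x) = n (initial x).
  have {}rho0 y : rho (initial y) = 0%E.
    have [y0|y0] := ltP y 0.
      suff -> : initial y = set0 by rewrite charge0.
      apply/seteqP; split => // z /= zy.
      by have := le_lt_trans zy y0; rewrite ltNge unitI_ge0.
    have [y1|y1] := leP y 1; first by apply: rho0; rewrite y0.
    suff -> : initial y = initial 1 by apply: rho0; rewrite ler01 lexx.
    apply/seteqP; split => z /= _; first exact: unitI_le1.
    by apply: le_trans (ltW y1); exact: unitI_le1.
  have mx := measurable_initial x.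
  have := rho0 x; rewrite rhoE // -[p _]fineK ?fin_num_measure //.
  rewrite -[n _]fineK ?fin_num_measure // -EFinB => -[] /eqP.
  by rewrite subr_eq0 => /eqP ->.
(* the uniqueness theorem is applied to the images of p and n on the line,
   where half-open intervals are known to generate the Borel sets *)
pose pR : {measure set R -> \bar R} :=
  measure_function_pushforward__canonical__measure_function_Measure p mval.
pose nR : {measure set R -> \bar R} :=
  measure_function_pushforward__canonical__measure_function_Measure n mval.
have pn A : measurable A -> p A = n A.
  move=> [B mB <-]; rewrite setTI.
  apply: (@measure_unique _ R _ (@ocitv R) (fun k => `]- k%:R, k%:R]%classic)
    _ _ _ _ pR nR) => //.
  - exact: ocitvI.
  - by move=> k; exact: is_ocitv.
  - apply/seteqP; split => // y _; exists (Num.trunc `|y|).+1 => //=.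
    rewrite in_itv /=; have := truncnS_gt `|y|; rewrite ltr_norml => /andP[-> /=].
    exact: ltW.
  - move=> _ [[a b] _ <-].
    change (p ((val : unitI R -> R) @^-1` `]a, b]) =
            n ((val : unitI R -> R) @^-1` `]a, b])).
    have -> : (val : unitI R -> R) @^-1` `]a, b] = initial b `\` initial a.
      apply/seteqP; split => y /=; rewrite in_itv /=.
        by move=> /andP[ay yb]; split => //; apply/negP; rewrite -ltNge.
      by move=> [yb /negP]; rewrite -ltNge => ->.
    have mI := measurable_initial.
    have muD (mu : {finite_measure set (unitI R) -> \bar R}) :
        mu (initial b `\` initial a) =
        (mu (initial b) - mu (initial (Num.min a b)))%E.
      rewrite measureD //; last by rewrite ltey_eq fin_num_measure.
      congr (_ - mu _)%E; apply/seteqP; split => y; rewrite /initial /= le_min.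
        by move=> [-> ->].
      by move=> /andP[].
    by rewrite !muD !pn_initial.
  - move=> k; rewrite ltey_eq; apply/orP; left.
    apply: (fin_num_measure p); rewrite -[X in measurable X]setTI.
    exact (mval measurableT _ (measurable_itv _)).
rewrite /Rintegral (@eq_measure_integral _ _ _ _ n p) ?subrr // => A mA _.
exact: pn.
Qed.
End InitialIntervals.

(** * The transfer operator on indicators of initial intervals *)

Section Step.
Variable R : realType.
Local Notation C := R[i].
Local Notation I := (unitI R).

Definition step (x : R) : I -> C := fun y => (\1_(initial x) y)%:C.

Lemma stepE x y : step x y = (val y <= x)%R%:R.
Proof.
rewrite /step indicE -(rmorph_nat (real_complex R)); congr (_%:C).
by congr ((_ : bool)%:R); apply/idP/idP; rewrite inE.
Qed.

(** An antitone function: its variation along a partition telescopes. *)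
Lemma step_bv x : step x \in @bv_pred R.
Proof.
apply/asboolP; exists 1 => _ [s [/(pathP I1) lt_s _] <-].
pose g n : R := (val (nth I1 (I0 :: s) n) <= x)%R%:R.
rewrite /cvariation (eq_big_nat _ _ (F2 := fun n => - g n.+1 - - g n)).
  by rewrite telescope_sumr // opprK addrC lerBlDr ler_wpDr // /g ?ler0n // lern1 leq_b1.
move=> n /andP[_ n_s]; rewrite /comp !stepE -!(rmorph_nat (real_complex R)) -rmorphB.
have := ltW (lt_s n n_s); rewrite leEsub /g /= => le_n.
set a := (val (nth _ s n) <= x); set b := (val _ <= x).
have ab : a ==> b by apply/implyP; exact: le_trans.
rewrite /normc /= expr0n addr0 sqrtr_sqr.
by case: a b ab => [] [] // _; rewrite /= ?subrr ?normr0 ?sub0r ?opprK ?addNr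
  ?oppr0 ?add0r ?normrN1.
Qed.

Definition BVstep x : BV R := MkBV (step_bv x).

Variable beta : R.
Hypothesis beta_gt1 : 1 < beta.
Let beta_gt0 : 0 < beta. Proof. exact: lt_trans beta_gt1. Qed.

(** The preimages [(s + j) / beta] of [s] that lie below [(k + t) / beta] are
    those with [s + j <= k + t], that is [j < k], or [j = k] and [s <= t].  At
    [s = 0] with [t = 1] the index [j = k + 1] would be added, and [s = 1] has
    no preimage: hence the open interval. *)
Lemma PF_step (k : nat) (t : R) (s : I) : 0 < val s < 1 -> 0 <= t <= 1 ->
  k%:R + t <= beta ->
  PF_fun beta (step ((k%:R + t) / beta)) s =
    (beta^-1)%:C * (k%:R * step 1 s + step t s).
Proof.
move=> /andP[s0 s1] /andP[t0 t1] ktb; set x := _ / beta.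
rewrite /PF_fun; congr (_ * _).
pose br (j : nat) : I := insubd I0 ((val s + j%:R) / beta).
pose N := (k + (val s <= t)%R)%N.
have ltN j : (j < N)%N = (val s + j%:R <= k%:R + t).
  rewrite /N; have [jk|kj|->] := ltngtP j k.
  - rewrite ltn_addr //; have : j%:R + 1 <= k%:R :> R by rewrite natr1 ler_nat.
    by move=> ?; apply/esym; lra.
  - have : k%:R + 1 <= j%:R :> R by rewrite natr1 ler_nat.
    move=> ?; have -> : (val s + j%:R <= k%:R + t) = false.
      by apply/negbTE; rewrite -ltNge; lra.
    by apply/negbTE; rewrite -leqNgt (leq_trans _ kj) // -addn1 leq_add2l leq_b1.
  - rewrite addrC lerD2l -{1}[k]addn0 ltn_add2l; by case: (_ <= _).
have val_br j : (j < N)%N -> val (br j) = (val s + j%:R) / beta.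
  rewrite ltN => le_kt; rewrite val_insubd mem_unitI //.
  rewrite divr_ge0 ?addr_ge0 ?(ltW s0) ?(ltW beta_gt0) //=.
  rewrite ler_pdivrMr // mul1r.
  exact: le_trans ktb.
pose r := [seq br j | j <- iota 0 N].
rewrite -(@fsbig_widen _ _ _ _ [set` r]).
- rewrite -fsbig_seq; last first.
    rewrite map_inj_in_uniq ?iota_uniq // => i j.
    rewrite !mem_iota !add0n /= => iN jN /(congr1 val).
    rewrite !val_br // => /divIf; rewrite gt_eqF // => /(_ isT) /addrI /eqP.
    by rewrite eqr_nat => /eqP.
  rewrite big_map (eq_big_seq (fun=> 1)).
    rewrite big_const_seq count_predT size_iota iter_addr_0 !stepE.
    by rewrite (ltW s1) mulr1 -natrD.
  move=> j; rewrite mem_iota add0n /= => jN.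
  by rewrite stepE val_br // /x ler_pM2r ?invr_gt0 // -ltN jN.
- move=> y /= /mapP[j]; rewrite mem_iota add0n /= => jN ->.
  apply: val_inj => /=; rewrite val_br // mulrCA mulfV ?gt_eqF // mulr1.
  rewrite (@floor_def _ _ j%:Z); first by rewrite addrK.
  by rewrite -[j%:~R]/(j%:R) intrD mulr1z -[j%:~R]/(j%:R); lra.
- move=> y [/= ys /negP yr]; rewrite stepE.
  case: (leP (val y) x) => // yx; case/negP: yr; move: yx.
  have by0 : 0 <= beta * val y by rewrite mulr_ge0 ?unitI_ge0 // ltW.
  have vs : val s = beta * val y - (Num.floor (beta * val y))%:~R by rewrite -ys.
  have : (0 <= Num.floor (beta * val y))%R by rewrite floor_ge0.
  case: (Num.floor (beta * val y)) vs => // m vs _.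
  have by_ : beta * val y = val s + m%:R by rewrite vs subrK.
  rewrite /x ler_pdivlMr // mulrC by_ -ltN => mN.
  apply/mapP; exists m; first by rewrite mem_iota add0n.
  by apply: val_inj; rewrite val_br // -by_ mulrC mulKf // gt_eqF.
Qed.

(** Functionals on the quotient do not charge points, so [F 0 = 0]. *)
Lemma BVclass_step0 : BVclass (BVstep 0) = 0.
Proof.
have -> : 0 = BVclass (0 : BV R) by rewrite /BVclass piE.
apply/BVclass_eq/asboolP; exists [set I0] => [|y y0].
  exact: finite_set_countable.
rewrite subr0 /= stepE leNgt lt_neqAle unitI_ge0 andbT; case: eqP => // e.
by case: y0; apply: val_inj.
Qed.

Lemma PF_BVstep (k : nat) (t : R) : 0 <= t <= 1 -> k%:R + t <= beta ->
  PF beta_gt1 (BVclass (BVstep ((k%:R + t) / beta))) =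
    (beta^-1)%:C *: (k%:R *: BVclass (BVstep 1) + BVclass (BVstep t)).
Proof.
move=> t01 ktb; rewrite PF_class -[k%:R *: _]BVclassZ -BVclassD -[RHS]BVclassZ.
apply/BVclass_eq/asboolP; exists [set I0; I1] => [|y /not_orP[y0 y1]].
  exact: finite_set_countable.
have -> : (PF_BV beta_gt1 (BVstep ((k%:R + t) / beta)) -
    (beta^-1)%:C *: (k%:R *: BVstep 1 + BVstep t)) y =
  PF_fun beta (step ((k%:R + t) / beta)) y -
    (beta^-1)%:C * (k%:R * step 1 y + step t y) by [].
rewrite PF_step ?subrr // !lt_neqAle unitI_ge0 unitI_le1 !andbT.
apply/andP; split; apply/eqP => e.
  by case: y0; apply: val_inj; rewrite -e.
by case: y1; apply: val_inj; rewrite e.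
Qed.

End Step.

Theorem theorem4p5 (R : realType) (beta : R) (beta_gt1 : 1 < beta)
    (beta_nonint : beta \isn't a Num.int) (lambda : R[i])
    (lambda_nonleading : nonleading_eigenvalue beta_gt1 lambda)
    (nu : BVhat R -> R[i]^o) (nu_eig : PF_eigenfunctional beta_gt1 lambda nu) :
  ~ exists m : complex_measure (unitI R) R,
      forall f : BV R, nu (BVclass f) = cintegral m f.
Proof.
move=> [m nuE]; have [[nu_lin _] nu_neq0 nu_eigE] := nu_eig.
have [_ lambda1 lambda_gt] := lambda_nonleading.
have beta_gt0 : 0 < beta by exact (lt_trans ltr01 beta_gt1).
have nu0 : nu 0 = 0.
  by have := nu_lin (-1) 0 0; rewrite scaler0 addr0 scaleN1r addNr.
have nuZ a u : nu (a *: u) = a * nu u.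
  by have := nu_lin a u 0; rewrite nu0 !addr0.
pose F x : R[i] := nu (BVclass (BVstep x)).
have FE x : F x = m (initial x).
  by rewrite /F nuE [LHS](cintegral_indic m (measurable_initial x)).
have F0 : F 0 = 0 by rewrite /F BVclass_step0.
have F_scaling (k : nat) t : 0 <= t -> t <= 1 -> k%:R + t <= beta ->
    beta%:C * lambda * F ((k%:R + t) / beta) = k%:R * F 1 + F t.
  move=> t0 t1 ktb.
  have : nu (PF beta_gt1 (BVclass (BVstep ((k%:R + t) / beta)))) =
      lambda * F ((k%:R + t) / beta) by exact: (congr1 (@^~ _) nu_eigE).
  rewrite PF_BVstep ?t0 // nuZ nu_lin => eigE.
  rewrite -mulrA -eigE mulrA -rmorphM mulfV ?gt_eqF // mul1r //.
have [M MP] := cmeas_increments m.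
have domM : dominates_increments F 1 (fun x => M (initial x)).
  move=> x y _ xy _; rewrite !FE.
  apply: MP; [exact: measurable_initial..|exact: initial_le].
have F_eq0 x : 0 <= x <= 1 -> F x = 0.
  apply: (scaling_trivial beta_gt1 _ F0 F_scaling domM lambda1).
  by rewrite mulrC -ltr_pdivrMr // mul1r.
have re0 f : charge_integral (cmeas_Re m) f = 0.
  by apply: charge_integral_vanish => x x01; rewrite /= /cmeas_Re -FE F_eq0.
have im0 f : charge_integral (cmeas_Im m) f = 0.
  by apply: charge_integral_vanish => x x01; rewrite /= /cmeas_Im -FE F_eq0.
case/eqP: nu_neq0; apply/funext => u; rewrite -(BVreprK u) nuE /cintegral.
by rewrite !re0 !im0 subrr addr0.
Qed.
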